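(* Let $n,s$ be positive integers and put $$N(n,s)=\sum_{m=1}^{n}\sum_{q=1}^{\min(m,s)}\binom{s}{q}\left\{\binom{-1+\frac{m}{2}}{q-1}'+\sum_{(n_1,\ldots,n_q)\in\Omega_q(m)}\left\lfloor \frac12\prod_{j=1}^{q}(n_j+1)\right\rfloor\right\}.$$ Then $$N(n,s)=T(n,2s)+T\!\left(\left\lfloor \tfrac n2\right\rfloor,s\right),\qquad\text{where } T(n,p)=-\frac12+\frac12\binom{n+p}{p}.$$
   Context: For real $p$ and integer $q$, $\binom{p}{q}'$ denotes $\binom{p}{q}$ if $p$ and $q$ are nonnegative integers, and $0$ otherwise. $\Omega_q(m)$ is the set of ordered $q$-tuples $(n_1,\ldots,n_q)$ of positive integers with $n_1+\cdots+n_q=m$. $\lfloor x\rfloor$ is the integer part. (Motivation: for a local ring $R$ with $2\in R^*$, $|R^*:R^{*2}|=2$, maximal ideal nilpotent of step $s$ and $(1+R^{*2})\subset R^{*2}$, this sum is known to count the classes of projectively congruent quadrics of $RP_{n-1}$; the theorem is the identity above.) *)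

(* Defs.v *)
From mathcomp Require Import all_boot all_order all_algebra.

Set Implicit Arguments.
Unset Strict Implicit.
Unset Printing Implicit Defensive.

Import Order.TTheory GRing.Theory Num.Theory.
Local Open Scope ring_scope.

Definition binom' (R : archiRealFieldType) (p : R) (q : int) : nat :=
  if (p \is a Num.nat) && (0 <= q) then 'C(Num.truncn p, `|q|%N) else 0%N.

(* The parts of a composition of m are at most m, so restricting the entries
   to 'I_m.+1 loses no tuple (see Omega_complete) and makes the set finite. *)
Definition Omega (q m : nat) : {set q.-tuple 'I_m.+1} :=
  [set t : q.-tuple 'I_m.+1 | [forall j, (0 < tnth t j)%N] && (\sum_(j < q) tnth t j == m)%N].

Lemma Omega_complete (q m : nat) (t : q.-tuple nat) :
  (forall j, 0 < tnth t j)%N -> (\sum_(j < q) tnth t j = m)%N ->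
  exists2 u, u \in Omega q m & t = map_tuple val u.
Proof.
move=> t_gt0 sum_t.
have le_tm j : (tnth t j < m.+1)%N by rewrite ltnS -sum_t (bigD1 j) //= leq_addr.
have uE j : tnth [tuple Ordinal (le_tm i) | i < q] j = tnth t j :> nat.
  by rewrite tnth_mktuple.
exists [tuple Ordinal (le_tm i) | i < q].
  rewrite inE; apply/andP; split; first by apply/forallP => j; rewrite uE.
  by apply/eqP; rewrite -[RHS]sum_t; apply: eq_bigr => j _; rewrite uE.
by apply: eq_from_tnth => j; rewrite tnth_map [RHS]uE.
Qed.

(* On nat, _ %/ 2 is the integer part of the half. *)
Definition N (R : archiRealFieldType) (n s : nat) : nat :=
  (\sum_(1 <= m < n.+1) \sum_(1 <= q < (minn m s).+1)
     'C(s, q) *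
       (binom' (- 1 + m%:R / 2 : R)%R (q%:Z - 1)%R
        + \sum_(t in Omega q m) (\prod_(j < q) (tnth t j + 1)) %/ 2))%N.

Definition T (R : archiRealFieldType) (n p : nat) : R :=
  - (1 / 2) + 1 / 2 * 'C(n + p, p)%:R.

(* Main.v *)
Require Import Defs.
From mathcomp Require Import all_boot all_order all_algebra.
From mathcomp Require Import ring zify.

Set Implicit Arguments.
Unset Strict Implicit.
Unset Printing Implicit Defensive.

Import Order.TTheory GRing.Theory Num.Theory.
Local Open Scope ring_scope.

(** A product is odd iff all its factors are, so twice the floor of half the
    product of the [n_j + 1] is that product minus the indicator that all [n_j]
    are even; and [binom'] counts the compositions of [m] into [q] even parts.
    Hence [2 N(n, s)] is a sum of weights [prod a(n_j)], for [a(k) = k + 1] and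
    for [a(k) = [k even]].  Since [a(0) = 1], summing over [q] with the factor
    [C(s, q)] is the binomial expansion of the [s]-th power of the generating
    series of [a], which is [1/(1-x)^2], resp. [1/(1-x^2)]; summing over [m] is
    multiplication by [1/(1-x)].  Power series are represented by polynomials
    that agree with them up to a large enough degree. *)

Lemma sum_bin_diag s m : (\sum_(i < m.+1) 'C(i + s, s) = 'C(m + s.+1, s.+1))%N.
Proof.
elim: m => [|m IHm]; first by rewrite big_ord1 !add0n !binn.
by rewrite big_ord_recr /= IHm [in RHS]addSn binS addSnnS.
Qed.

Section TruncatedSeries.

Variable S : comNzSemiRingType.
Implicit Types (p r : {poly S}) (a : nat -> S).

Lemma eq_coefM N p p' r r' :
    (forall i, (i < N)%N -> p`_i = p'`_i) ->
    (forall i, (i < N)%N -> r`_i = r'`_i) ->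
  forall i, (i < N)%N -> (p * r)`_i = (p' * r')`_i.
Proof.
move=> Ep Er i ltiN; rewrite !coefM; apply: eq_bigr => j _.
by rewrite Ep ?Er //; have := ltn_ord j; lia.
Qed.

Lemma eq_coefX N p p' s :
    (forall i, (i < N)%N -> p`_i = p'`_i) ->
  forall i, (i < N)%N -> (p ^+ s)`_i = (p' ^+ s)`_i.
Proof.
by move=> Ep; elim: s => [|s IHs] i ltiN; rewrite ?expr0 // !exprS; apply: eq_coefM ltiN.
Qed.

Definition geom N : {poly S} := \poly_(i < N) 1.

Lemma coef_geomM N p m : (m < N)%N -> (geom N * p)`_m = \sum_(i < m.+1) p`_i.
Proof.
move=> ltmN; rewrite mulrC coefM; apply: eq_bigr => j _.
by rewrite coef_poly ifT ?mulr1 //; lia.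
Qed.

(** Each further factor [geom N] replaces coefficients by their partial sums, so the induction is
    the hockey-stick identity [sum_bin_diag]. *)
Lemma coef_geomX N s m : (m < N)%N -> (geom N ^+ s.+1)`_m = 'C(m + s, s)%:R.
Proof.
elim: s m => [|s IHs] m ltmN; first by rewrite expr1 coef_poly ltmN bin0.
rewrite exprS coef_geomM // -sum_bin_diag natr_sum.
by apply: eq_bigr => i _; rewrite IHs //; have := ltn_ord i; lia.
Qed.

Lemma coef_geom2 N i : (i < N)%N -> (\poly_(i < N) i.+1%:R)`_i = (geom N ^+ 2)`_i.
Proof. by move=> ltiN; rewrite coef_geomX // coef_poly ltiN addn1 bin1. Qed.

Lemma coef_geom_even N i : (i < N)%N ->
  (\poly_(i < N) (odd i.+1)%:R)`_i = (geom N \Po 'X^2)`_i.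
Proof.
move=> ltiN; rewrite coef_comp_poly_Xn // !coef_poly ltiN dvdn2 /=.
by case: odd => //=; rewrite ifT //; lia.
Qed.

(** Distributing the power over its [q] factors gives one monomial per choice of exponents. The
    coefficient at [m] keeps the choices of total [m], and the missing constant term discards those
    with a zero part. *)
Lemma sum_Omega_coef a q m N : (m <= N)%N ->
  \sum_(t in Omega q m) \prod_(j < q) a (tnth t j)
    = (('X * \poly_(i < N) a i.+1) ^+ q)`_m.
Proof.
move=> lemN; pose c k := if k == 0%N then 0 else a k.
(* Cutting at degree [m] makes the exponents range over ['I_m.+1], as the entries of the tuples do;
   [c] vanishes at 0 in place of the factor ['X]. *)
rewrite (@eq_coefX m.+1 _ (\poly_(k < m.+1) c k)) //; last first.
  move=> i ltim; rewrite coefXM !coef_poly ltim /c; case: i ltim => //= i ltim.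
  by rewrite ifT //; lia.
rewrite poly_def -[q in _ ^+ q]card_ord -prodr_const bigA_distr_bigA coef_sum.
rewrite (reindex (fun t : q.-tuple 'I_m.+1 => [ffun j => tnth t j])) /=; last first.
  exists (fun f : {ffun 'I_q -> 'I_m.+1} => [tuple f j | j < q]) => [t _|f _].
    by apply: eq_from_tnth => j; rewrite tnth_mktuple ffunE.
  by apply/ffunP => j; rewrite ffunE tnth_mktuple.
rewrite big_mkcond /=; apply: eq_bigr => t _.
under [in RHS]eq_bigr do rewrite ffunE.
rewrite scaler_prod prodrXr coefZ coefXn inE [m == _]eq_sym.
case: eqP => _; rewrite ?andbF ?mulr0 // andbT mulr1.
case: (boolP [forall _, _]) => [/forallP t_gt0|].
  by apply: eq_bigr => j _; rewrite /c gtn_eqF.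
rewrite negb_forall => /existsP[j]; rewrite -eqn0Ngt => tj0.
by rewrite (bigD1 j) //= /c tj0 mul0r.
Qed.

(** Binomial expansion of [(1 + 'X * _) ^+ s]: the term [q = 0] is constant, hence invisible at
    [m > 0], and the terms with [q > m] are divisible by a too high power of ['X]. *)
Lemma sum_bin_coef a s m N : a 0%N = 1 -> (0 < m)%N ->
  \sum_(1 <= q < (minn m s).+1) 'C(s, q)%:R * (('X * \poly_(i < N) a i.+1) ^+ q)`_m
    = ((\poly_(i < N.+1) a i) ^+ s)`_m.
Proof.
move=> a0 m_gt0; have ->: \poly_(i < N.+1) a i = 1 + 'X * \poly_(i < N) a i.+1.
  apply/polyP => -[|i]; rewrite coefD coef1 coefXM !coef_poly /= ?a0 ?addr0 //.
  by rewrite add0r ltnS.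
rewrite exprDn coef_sum -(big_mkord xpredT (fun i =>
  (1 ^+ (s - i) * ('X * \poly_(i < N) a i.+1) ^+ i *+ 'C(s, i))`_m)).
rewrite big_ltn // expr0 mulr1 expr1n coefMn coef1 gtn_eqF // mul0rn add0r.
rewrite [RHS](@big_cat_nat _ _ _ (minn m s).+1) ?ltnS ?geq_minr //=.
rewrite [X in _ + X]big_nat [X in _ + X]big1 ?addr0 => [|i /andP[lti _]].
  by apply: eq_bigr => i _; rewrite expr1n mul1r coefMn mulr_natl.
rewrite expr1n mul1r coefMn exprMn coefXnM; case: ltnP => [_|leim].
  by rewrite mul0rn.
by rewrite bin_small // ?mulr0n //; lia.
Qed.

(** The base is x/(1-x) evaluated at x^2, so odd degrees vanish and an even [m] reads off the
    coefficient of (x/(1-x))^q at [m./2]. *)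
Lemma coef_even_compositions q m N : (0 < q)%N -> (0 < m <= N)%N ->
  (('X * \poly_(i < N) (odd i.+2)%:R : {poly S}) ^+ q)`_m
    = (if odd m then 0 else 'C(m./2.-1, q.-1))%:R.
Proof.
case: q => // q _ /andP[m_gt0 lemN].
rewrite (@eq_coefX m.+1 _ (('X * geom m.+1) \Po 'X^2)) //; last first.
  move=> i ltim; rewrite coef_comp_poly_Xn // !coefXM !coef_poly dvdn2.
  case: i ltim => //= i ltim; rewrite ifT; last by lia.
  rewrite negbK; case Ei: (odd i) => //=; rewrite ifN ?ifT //; lia.
rewrite -rmorphXn /= coef_comp_poly_Xn // dvdn2; case: ifP => /=; last first.
  by move/negbFE->.
move/negPf=> Em; rewrite Em exprMn coefXnM divn2.
case: ltnP => [lt_mq|le_qm]; first by rewrite bin_small //; lia.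
rewrite coef_geomX; last by lia.
by congr ('C(_, _)%:R); lia.
Qed.

Lemma sum_coef_linear n s :
  \sum_(m < n.+1) ((\poly_(i < n.+1) i.+1%:R : {poly S}) ^+ s)`_m
    = 'C(n + 2 * s, 2 * s)%:R.
Proof.
rewrite -(@coef_geomX n.+1) // exprS coef_geomM //; apply: eq_bigr => i _.
by rewrite exprM; apply: (@eq_coefX n.+1) => // j; apply: coef_geom2.
Qed.

Lemma sum_even (f : nat -> S) n :
  \sum_(m < n.+1) (if (2 %| m)%N then f (m %/ 2)%N else 0)
    = \sum_(k < (n %/ 2).+1) f k.
Proof.
elim: n => [|n IHn]; first by rewrite !big_ord1.
rewrite big_ord_recr /= IHn; case: ifP => dvd2.
  have ->: (n.+1 %/ 2 = (n %/ 2).+1)%N by lia.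
  by rewrite [RHS]big_ord_recr.
have ->: (n.+1 %/ 2 = n %/ 2)%N by lia.
by rewrite addr0.
Qed.

(** Powers of 1/(1-x^2) live in even degrees, so summing up to [n] amounts to summing the
    coefficients of the powers of 1/(1-x) up to [n %/ 2]. *)
Lemma sum_coef_even n s :
  \sum_(m < n.+1) ((\poly_(i < n.+1) (odd i.+1)%:R : {poly S}) ^+ s)`_m
    = 'C(n %/ 2 + s, s)%:R.
Proof.
rewrite -(@coef_geomX n.+1); last by lia.
rewrite exprS coef_geomM; last by lia.
rewrite -(sum_even (fun i => (geom n.+1 ^+ s)`_i)); apply: eq_bigr => i _.
rewrite -coef_comp_poly_Xn // rmorphXn /=.
by apply: (@eq_coefX n.+1) => // j; apply: coef_geom_even.
Qed.

End TruncatedSeries.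

(** For odd [m] the upper argument is not an integer, so the default value 0 applies; for even
    [m > 0] it is the natural number [m./2.-1]. *)
Lemma binom'_half (R : archiRealFieldType) m q : (0 < m)%N -> (0 < q)%N ->
  binom' (- 1 + m%:R / 2 : R) (q%:Z - 1) = if odd m then 0%N else 'C(m./2.-1, q.-1).
Proof.
case: q => // q m_gt0 _; rewrite /binom' /=.
have ->: q.+1%:Z - 1 = q by lia.
rewrite /= andbT; case Em: (odd m).
  case: natrP => // -[k Ek]; have /eqP: (m%:R = (2 * k.+1)%:R :> R).
    by rewrite natrM -[k.+1%:R]natr1 -Ek; field.
  by rewrite eqr_nat => /eqP mE; move: Em; rewrite mE; lia.
have ->: - 1 + m%:R / 2 = (m./2.-1)%:R :> R.
  have {1}->: m = (2 * (m./2.-1).+1)%N by lia.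
  by rewrite natrM -[(_.-1).+1%:R]natr1; field.
by rewrite natr_nat natrK subn1.
Qed.

Lemma half_prod_parity (I : finType) (x : I -> nat) :
  ((\prod_i x i) %/ 2 * 2 + \prod_i odd (x i) = \prod_i x i)%N.
Proof.
have ->: (\prod_i odd (x i) = odd (\prod_i x i))%N.
  by apply/esym/(big_morph (fun k => odd k : nat)) => // y z; rewrite oddM mulnb.
by lia.
Qed.

Theorem theorem1 (R : archiRealFieldType) (n s : nat)
    (n_gt0 : (0 < n)%N) (s_gt0 : (0 < s)%N) :
  (N R n s)%:R = T R n (2 * s)%N + T R (n %/ 2)%N s.
Proof.
pose lin := \poly_(i < n.+1) i.+1%:R : {poly R}.
pose evn := \poly_(i < n.+1) (odd i.+1)%:R : {poly R}.
suff EN: (N R n s)%:R * 2 = \sum_(1 <= m < n.+1) ((lin ^+ s)`_m + (evn ^+ s)`_m).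
  (* The added 2 is the term [m = 0], both powers having constant coefficient 1; it accounts for the
     two summands -1/2 in the values of [T]. *)
  have E2: (N R n s)%:R * 2 + 2 = ('C(n + 2 * s, 2 * s)%:R + 'C(n %/ 2 + s, s)%:R : R).
    rewrite -sum_coef_linear -sum_coef_even -big_split /=.
    rewrite -(big_mkord xpredT (fun m => (lin ^+ s)`_m + (evn ^+ s)`_m)) big_ltn //.
    by rewrite EN -!horner_coef0 !horner_exp !horner_coef0 !coef_poly !expr1n addrC.
  have ->: (N R n s)%:R = ((N R n s)%:R * 2 + 2 - 2) / 2 :> R by field.
  by rewrite E2 /T; field.
rewrite natr_sum mulr_suml; apply: eq_big_nat => m /andP[m_gt0 lemn].
rewrite -!(@sum_bin_coef _ _ s m n) // -big_split /= natr_sum mulr_suml.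
apply: eq_big_nat => q /andP[q_gt0 _].
rewrite natrM /= -mulrDr -mulrA; congr (_ * _).
rewrite -(@sum_Omega_coef _ (fun i => i.+1%:R)) //.
have EO : (binom' (- 1 + m%:R / 2 : R) (q%:Z - 1))%:R =
    \sum_(t in Omega q m) \prod_(j < q) (odd (tnth t j).+1)%:R :> R.
  rewrite (@sum_Omega_coef _ (fun i => (odd i.+1)%:R) q m n) //.
  by rewrite coef_even_compositions ?m_gt0 // binom'_half.
rewrite coef_even_compositions ?m_gt0 // -(binom'_half R) //.
(* Doubling yields two copies of [binom']: one cancels against the even coefficient, the other
   supplies, through [EO], the parity indicators that complete the doubled floors to full
   products. *)
rewrite natrD mulrDl {1}mulr_natr mulr2n -addrA addrC; congr (_ + _).
rewrite EO natr_sum mulr_suml -big_split; apply: eq_bigr => t _ /=.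
rewrite -!natr_prod -natrM -natrD addnC.
under [in RHS]eq_bigr do rewrite -addn1.
rewrite -[in RHS](half_prod_parity (fun j => tnth t j + 1)%N).
by congr (_ + _)%:R; apply: eq_bigr => j _; rewrite addn1.
Qed.
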